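(* Let $1/2<\mu\le 2$ and $0<\nu<1/2$. Let $g\in C(\mathbb{R})\cap L^\infty(\mathbb{R})$ be a solution of system (3.12) (i.e. $g=T[g]$), and set $G(x)=g(x)+\tfrac12(\mu-\nu)\ln(x^2+1)$. Assume that $G$ is even and increasing on $[0,\infty)$. Then there exist $x_0>0$ and a constant $c(\mu,\nu)$ depending only on $\mu,\nu$ such that $$\Big\|G(x)-\tfrac12(\mu-\nu)\ln(x^2+x_0^2)\Big\|_{L^\infty(\mathbb{R})}\le c(\mu,\nu).$$
   Context: Let $\theta:\mathbb{R}\to\mathbb{R}$ be the continuous branch of $\arg(x-i)$ with values in $(-\pi,0)$: $\theta(x)=\arctan(-1/x)$ for $x>0$, $\theta(0)=-\pi/2$, $\theta(x)=\arctan(-1/x)-\pi$ for $x<0$; so $\theta(+\infty)=0$, $\theta(-\infty)=-\pi$. For real $g\in C(\mathbb{R})\cap L^\infty(\mathbb{R})$ define: $h^{-1}:\mathbb{R}\to\mathbb{R}$ by $h^{-1}(0)=0$ and $(h^{-1})'(x)=|x|^{\nu-1}(x^2+1)^{(\mu-\nu)/2}e^{g(x)}$ for $x\neq0$; $\kappa>0$ the constant with $\int_{\mathbb{R}}\frac{\kappa}{x\,h^{-1}(x)(h^{-1})'(x)}\,dx=(\mu-\nu)\pi$; $F$ the continuous function with $F'(x)=\frac{\kappa}{x\,h^{-1}(x)(h^{-1})'(x)}$ for $x\ne0$ and $F(+\infty)=0$ (hence $F(-\infty)=-(\mu-\nu)\pi$); and $T[g]=H\big(F-(\mu-\nu)\theta\big)$,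 where $H$ is the Hilbert transform $Hf(x)=\frac1\pi\,\mathrm{p.v.}\int_{\mathbb{R}}\frac{f(y)}{x-y}\,dy$ (principal value at $y=x$ and at infinity). ''$g$ solves system (3.12)'' means $g=T[g]$. *)

(* Defs.v *)
From Stdlib Require Export Reals.
Open Scope R_scope.

(* theta = continuous branch of arg(x - i) with values in (-pi, 0) *)
Definition theta (x : R) : R :=
  if Rlt_dec 0 x then atan (- / x)
  else if Req_EM_T x 0 then - (PI / 2)
  else atan (- / x) - PI.

Definition RInt_eq (f : R -> R) (a b I : R) : Prop :=
  exists pr : Riemann_integrable f a b, RiemannInt pr = I.

(* Improper integral over R, with possible singularity at 0 and at +-infinity:
   int_R f = lim_{eps->0+, M->+oo} ( int_{-M}^{-eps} f + int_{eps}^{M} f ) = L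
   (the four endpoints tend independently). *)
Definition improper_int_R (f : R -> R) (L : R) : Prop :=
  forall eps, 0 < eps -> exists d M, 0 < d /\ 0 < M /\
    forall a b c e, 0 < a < d -> M < b -> 0 < c < d -> M < e ->
      exists I1 I2, RInt_eq f (- e) (- c) I1 /\ RInt_eq f a b I2 /\
                    Rabs (I1 + I2 - L) < eps.

Definition lim_pinf (f : R -> R) (l : R) : Prop :=
  forall eps, 0 < eps -> exists M, forall x, M < x -> Rabs (f x - l) < eps.

(* Hilbert transform as principal value (at y = x and at infinity):
   Hf(x) = (1/pi) lim_{e->0+, R->+oo} int_{e < |x-y| < R} f(y)/(x-y) dy = L *)
Definition hilbert_pv (f : R -> R) (x L : R) : Prop :=
  forall eps, 0 < eps -> exists d M, 0 < d /\ 0 < M /\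
    forall e Rr, 0 < e < d -> M < Rr ->
      exists I1 I2,
        RInt_eq (fun y => f y / (x - y)) (x - Rr) (x - e) I1 /\
        RInt_eq (fun y => f y / (x - y)) (x + e) (x + Rr) I2 /\
        Rabs ((I1 + I2) / PI - L) < eps.

(* g solves system (3.12): g = T[g], where T[g] is built from
   h^{-1}, kappa, F as in the paper.  These auxiliary objects are uniquely
   determined by their defining properties, so they are quantified
   existentially. *)
Definition solves_312 (mu nu : R) (g : R -> R) : Prop :=
  exists (hinv : R -> R) (kappa : R) (F : R -> R),
    continuity hinv /\ hinv 0 = 0 /\
    (forall x, x <> 0 ->
       derivable_pt_lim hinv x
         (Rpower (Rabs x) (nu - 1) * Rpower (x ^ 2 + 1) ((mu - nu) / 2)
          * exp (g x))) /\
    0 < kappa /\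
    improper_int_R
      (fun x => kappa / (x * hinv x *
         (Rpower (Rabs x) (nu - 1) * Rpower (x ^ 2 + 1) ((mu - nu) / 2)
          * exp (g x))))
      ((mu - nu) * PI) /\
    continuity F /\
    (forall x, x <> 0 ->
       derivable_pt_lim F x
         (kappa / (x * hinv x *
           (Rpower (Rabs x) (nu - 1) * Rpower (x ^ 2 + 1) ((mu - nu) / 2)
            * exp (g x))))) /\
    lim_pinf F 0 /\
    (forall x, hilbert_pv (fun y => F y - (mu - nu) * theta y) x (g x)).

Definition Gof (mu nu : R) (g : R -> R) (x : R) : R :=
  g x + (mu - nu) / 2 * ln (x ^ 2 + 1).

(* Main.v *)
Require Import Defs.
From Stdlib Require Import Reals Lra FunctionalExtensionality.
From Coquelicot Require Import Coquelicot.
Open Scope R_scope.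

(** Write [al = mu - nu] and [m = F - F 0].  Since [F'] is even and, by monotonicity
    of [G], decreasing on the positive axis, [m] is odd, increasing to [al * PI / 2],
    and [m x / x] is decreasing; moreover [theta = atan - PI / 2].  For such profiles
    the symmetric form of the Hilbert integral, [(A (t - r) - A (t + r)) / r], is
    integrable on [0 < r < t] and close to [- 2 A r / r] for [r > t], with total errors
    depending only on [al].  Hence [G] agrees up to a bounded error with [J], where
    [J' x = (2 / PI) * m x / x].  With [u = ln x], [phi u = J x] and [n = phi'], the
    equation for [F'] becomes [c E <= n' <= C E] with [E = exp ((1 - 2 nu) u - 2 phi)]
    and [C / c] depending only on [mu, nu].  As [E' = 2 (p - n) E] for [p = 1/2 - nu],
    the function [C E - (2 p n - n^2)] is monotone up to the point [u0] where [n = p],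
    which yields [p n <= C E <= (C / c) n'], so [phi u0 - phi u <= C / c] on the left of
    [u0]; the right side is symmetric.  Thus [x0 = exp u0] works, the additive constant
    being fixed by the bound [|g| <= 6 al + 3] near infinity, which follows from the
    convergence of the Hilbert integral at [0]. *)

(** * Mean value and monotonicity tools *)

(** Differentiability is asked for only inside the interval, because [h] and [m] below are known to
    be continuous but not differentiable at [0]. *)
Lemma MVT_open (f df : R -> R) (a b : R) :
  a < b ->
  (forall x, a < x < b -> derivable_pt_lim f x (df x)) ->
  (forall x, a <= x <= b -> continuity_pt f x) ->
  exists c, a < c < b /\ f b - f a = df c * (b - a).
Proof.
  intros Hab Hd Hc.
  pose (pr1 := fun c (H : a < c < b) =>
    exist (fun l => derivable_pt_lim f c l) (df c) (Hd c H) : derivable_pt f c).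
  pose (pr2 := fun c (_ : a < c < b) => derivable_pt_id c).
  destruct (MVT f id a b pr1 pr2 Hab Hc) as [c [P E]].
  { intros c _. apply derivable_continuous_pt, derivable_pt_id. }
  exists c; split; [exact P|].
  unfold pr2 in E; rewrite derive_pt_id in E.
  change (derive_pt f c (pr1 c P)) with (df c) in E.
  unfold id in E; lra.
Qed.

Lemma le_of_derive_nonneg (f df : R -> R) (a b : R) :
  a <= b ->
  (forall x, a < x < b -> derivable_pt_lim f x (df x)) ->
  (forall x, a <= x <= b -> continuity_pt f x) ->
  (forall x, a < x < b -> 0 <= df x) ->
  f a <= f b.
Proof.
  intros Hab Hd Hc Hp.
  destruct (Req_dec a b) as [->|Hne]; [lra|].
  destruct (MVT_open f df a b) as [c [Hcab E]]; try assumption; [lra|].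
  specialize (Hp c Hcab). nra.
Qed.

Lemma derivable_pt_lim_continuity_pt (f : R -> R) (x l : R) :
  derivable_pt_lim f x l -> continuity_pt f x.
Proof.
  intros H. apply derivable_continuous_pt. exists l. exact H.
Qed.

(** * A differential inequality of Liouville type *)

Lemma liouville_half_line (phi n N E : R -> R) (p c C u0 : R) :
  0 < p -> 0 < c -> 0 < C ->
  (forall u, derivable_pt_lim phi u (n u)) ->
  (forall u, derivable_pt_lim n u (N u)) ->
  (forall u, derivable_pt_lim E u (2 * (p - n u) * E u)) ->
  (forall u, 0 < E u) ->
  (forall u, c * E u <= N u <= C * E u) ->
  (forall u, 0 <= n u) ->
  (forall eps, 0 < eps -> exists M, forall u, u < M -> n u < eps) ->
  n u0 = p ->
  forall u, u <= u0 -> 0 <= phi u0 - phi u <= C / c.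
Proof.
  intros Hp Hc HC Dphi Dn DE HE HN Hn0 Hlim Hu0.
  assert (Hmono : forall u v, u <= v -> n u <= n v).
  { intros u v Huv. apply (le_of_derive_nonneg n N); auto.
    - intros x _. eapply derivable_pt_lim_continuity_pt, Dn.
    - intros x _. specialize (HE x). specialize (HN x). nra. }
  (* The derivative of [Q] factors as [2 (p - n) (C E - N)], which is nonnegative as long as
     [n <= p]. *)
  pose (Q := fun u => C * E u - (2 * p * n u - n u * n u)).
  assert (DQ : forall u, derivable_pt_lim Q u
            (C * (2 * (p - n u) * E u) - (2 * p * N u - (N u * n u + n u * N u)))).
  { intros u. unfold Q.
    apply derivable_pt_lim_minus.
    - apply derivable_pt_lim_scal, DE.
    - apply derivable_pt_lim_minus.
      + apply derivable_pt_lim_scal, Dn.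
      + apply derivable_pt_lim_mult; apply Dn. }
  assert (HQ : forall u, u <= u0 -> 0 <= Q u).
  { intros u Hu. apply Rnot_lt_le. intros Hneg.
    (* If [Q u < 0], then far to the left [2 p n v < - Q u], so [Q v >= - 2 p n v > Q u]. This
       contradicts the monotonicity of [Q] on the left of [u0]. *)
    destruct (Hlim (- Q u / (2 * p))) as [M HM].
    { apply Rdiv_lt_0_compat; lra. }
    set (v := Rmin (M - 1) u).
    assert (Hv : v <= M - 1 /\ v <= u) by (split; [apply Rmin_l | apply Rmin_r]).
    assert (Hnv : n v < - Q u / (2 * p)) by (apply HM; lra).
    assert (Hnv' : 2 * p * n v < - Q u).
    { apply (Rmult_lt_compat_l (2 * p)) in Hnv; [|lra].
      replace (2 * p * (- Q u / (2 * p))) with (- Q u) in Hnv by (field; lra). lra. }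
    assert (Q v <= Q u).
    { eapply le_of_derive_nonneg; [lra | intros x _; apply DQ | | ].
      - intros x _. eapply derivable_pt_lim_continuity_pt, DQ.
      - intros x Hx. simpl.
        assert (n x <= p) by (rewrite <- Hu0; apply Hmono; lra).
        specialize (HN x). nra. }
    assert (0 <= C * E v + n v * n v).
    { specialize (HE v). nra. }
    unfold Q in *. lra. }
  intros u Hu.
  split.
  - enough (phi u <= phi u0) by lra.
    apply (le_of_derive_nonneg phi n); auto.
    intros x _. eapply derivable_pt_lim_continuity_pt, Dphi.
  (* From [Q >= 0] and [n <= p] one gets [p n <= 2 p n - n^2 <= C E <= (C / c) N], that is
     [n <= k N]. Hence [k n - phi] is nondecreasing, and [k n u0 = C / c]. *)
  - pose (k := C / (p * c)).
    assert (Hmon : k * n u - phi u <= k * n u0 - phi u0).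
    { apply (le_of_derive_nonneg (fun u => k * n u - phi u) (fun u => k * N u - n u)); auto.
      - intros x _. apply derivable_pt_lim_minus; auto.
        apply derivable_pt_lim_scal, Dn.
      - intros x _. apply derivable_pt_lim_continuity_pt with (k * N x - n x).
        apply derivable_pt_lim_minus; auto.
        apply derivable_pt_lim_scal, Dn.
      - intros x Hx.
        assert (Hx0 : x <= u0) by lra.
        specialize (HQ x Hx0). unfold Q in HQ.
        assert (n x <= p) by (rewrite <- Hu0; apply Hmono; lra).
        specialize (HN x). specialize (Hn0 x). specialize (HE x).
        assert (p * n x <= C * E x) by nra.
        assert (E x <= N x / c).
        { apply (Rmult_le_reg_l c); [lra|].
          replace (c * (N x / c)) with (N x) by (field; lra). lra. }
        assert (p * n x <= C * (N x / c)) by nra.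
        apply (Rmult_le_reg_l p); [lra|].
        unfold k. replace (p * (C / (p * c) * N x - n x))
          with (C * (N x / c) - p * n x) by (field; lra). lra. }
    assert (0 <= k * n u).
    { apply Rmult_le_pos; auto. unfold k. apply Rlt_le, Rdiv_lt_0_compat; nra. }
    assert (k * n u0 = C / c) by (rewrite Hu0; unfold k; field; lra).
    lra.
Qed.

Lemma derivable_pt_lim_reflect (f : R -> R) (x l : R) :
  derivable_pt_lim f (- x) l -> derivable_pt_lim (fun v => f (- v)) x (- l).
Proof.
  intros H. replace (- l) with (l * (- 1)) by ring.
  apply (derivable_pt_lim_comp (fun v => - v) f).
  - apply derivable_pt_lim_opp, derivable_pt_lim_id.
  - exact H.
Qed.

(* The right half-line is the left one after [u -> - u], [n -> p + q - n]. *)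
Lemma liouville_line (phi n N E : R -> R) (p q c C u0 : R) :
  0 < p -> 0 < q -> 0 < c -> 0 < C ->
  (forall u, derivable_pt_lim phi u (n u)) ->
  (forall u, derivable_pt_lim n u (N u)) ->
  (forall u, derivable_pt_lim E u (2 * (p - n u) * E u)) ->
  (forall u, 0 < E u) ->
  (forall u, c * E u <= N u <= C * E u) ->
  (forall u, 0 <= n u <= p + q) ->
  (forall eps, 0 < eps -> exists M, forall u, u < M -> n u < eps) ->
  (forall eps, 0 < eps -> exists M, forall u, M < u -> p + q - eps < n u) ->
  n u0 = p ->
  forall u, Rabs (phi u - phi u0 - (p + q) * Rmax (u - u0) 0) <= C / c.
Proof.
  intros Hp Hq Hc HC Dphi Dn DE HE HN Hn Hl Hr Hu0 u.
  destruct (Rle_dec u u0) as [Hu|Hu].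
  - rewrite Rmax_right by lra.
    assert (H := liouville_half_line phi n N E p c C u0 Hp Hc HC Dphi Dn DE HE HN
                  (fun u => proj1 (Hn u)) Hl Hu0 u Hu).
    apply Rabs_le. lra.
  - rewrite Rmax_left by lra.
    assert (H : 0 <= ((p + q) * (- u0) + phi (- - u0)) - ((p + q) * (- u) + phi (- - u)) <= C / c).
    { apply (liouville_half_line (fun v => (p + q) * v + phi (- v)) (fun v => p + q - n (- v))
               (fun v => N (- v)) (fun v => E (- v)) q c C (- u0)); auto.
      - intros v. replace (p + q - n (- v)) with ((p + q) * 1 + - n (- v)) by ring.
        apply derivable_pt_lim_plus.
        + apply derivable_pt_lim_scal, derivable_pt_lim_id.
        + apply derivable_pt_lim_reflect, Dphi.
      - intros v. replace (N (- v)) with (0 - - N (- v)) by ring.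
        apply derivable_pt_lim_minus.
        + apply derivable_pt_lim_const.
        + apply derivable_pt_lim_reflect, Dn.
      - intros v. replace (2 * (q - (p + q - n (- v))) * E (- v))
          with (- (2 * (p - n (- v)) * E (- v))) by ring.
        apply derivable_pt_lim_reflect, DE.
      - intros v. specialize (Hn (- v)). lra.
      - intros eps Heps. destruct (Hr eps Heps) as [M HM].
        exists (- M). intros v Hv. assert (M < - v) by lra. specialize (HM _ H). lra.
      - rewrite Ropp_involutive. lra.
      - lra. }
    rewrite !Ropp_involutive in H. apply Rabs_le. lra.
Qed.

(** * The Hilbert transform of an odd profile *)

Lemma continuity_pt_continuous (f : R -> R) (x : R) :
  continuity_pt f x <-> continuous f x.
Proof. exact (continuity_pt_filterlim f x). Qed.

Lemma ex_RInt_of_continuity (f : R -> R) (a b : R) :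
  a <= b -> (forall x, a <= x <= b -> continuity_pt f x) -> ex_RInt f a b.
Proof.
  intros Hab Hf. apply (@ex_RInt_continuous R_CompleteNormedModule).
  intros z. rewrite Rmin_left, Rmax_right by lra.
  intros Hz. apply continuity_pt_continuous; auto.
Qed.

Lemma RInt_eq_RInt (f : R -> R) (a b I : R) :
  RInt_eq f a b I -> ex_RInt f a b /\ RInt f a b = I.
Proof.
  intros [pr H]. split.
  - apply ex_RInt_Reals_1, pr.
  - rewrite <- H. apply RInt_Reals.
Qed.

Lemma RInt_primitive (F f : R -> R) (a b : R) :
  a <= b ->
  (forall x, a <= x <= b -> derivable_pt_lim F x (f x)) ->
  (forall x, a <= x <= b -> continuity_pt f x) ->
  RInt f a b = F b - F a.
Proof.
  intros Hab HF Hf. apply is_RInt_unique.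
  apply (is_RInt_derive F f).
  - intros x. rewrite Rmin_left, Rmax_right by lra. intros Hx.
    apply is_derive_Reals; auto.
  - intros x. rewrite Rmin_left, Rmax_right by lra. intros Hx.
    apply continuity_pt_continuous; auto.
Qed.

Lemma RInt_abs_le_primitive (f k K : R -> R) (a b : R) :
  a <= b ->
  (forall x, a <= x <= b -> continuity_pt f x) ->
  (forall x, a <= x <= b -> derivable_pt_lim K x (k x)) ->
  (forall x, a <= x <= b -> continuity_pt k x) ->
  (forall x, a < x < b -> Rabs (f x) <= k x) ->
  Rabs (RInt f a b) <= K b - K a.
Proof.
  intros Hab Hf HK Hk Hle.
  rewrite <- (RInt_primitive K k a b Hab HK Hk).
  eapply Rle_trans.
  - apply abs_RInt_le; auto. apply ex_RInt_of_continuity; auto.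
  - apply RInt_le; auto; apply ex_RInt_of_continuity; auto.
    intros x Hx. apply (continuity_pt_comp f Rabs); auto. apply Rcontinuity_abs.
Qed.

(** The substitutions [y = x - s] and [y = x + s] fold both halves of the truncated integral onto
    [[e, r]]; the kernel changes sign between them. *)
Lemma hilbert_pv_symmetric (A : R -> R) (x L : R) :
  hilbert_pv A x L ->
  forall eps, 0 < eps -> exists d M, 0 < d /\ 0 < M /\
    forall e r, 0 < e < d -> M < r ->
      Rabs (RInt (fun s => (A (x - s) - A (x + s)) / s) e r / PI - L) < eps.
Proof.
  intros H eps Heps. destruct (H eps Heps) as (d & M & Hd & HM & Hint).
  exists d, M. repeat split; auto.
  intros e r He Hr. destruct (Hint e r He Hr) as (I1 & I2 & H1 & H2 & Hlt).
  apply RInt_eq_RInt in H1, H2. destruct H1 as [X1 E1], H2 as [X2 E2].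
  set (f := fun y => A y / (x - y)) in *.
  (* The endpoints are put in the affine form that [RInt_comp_lin] expects. *)
  replace (x - r) with ((-1) * r + x) in X1, E1 by ring.
  replace (x - e) with ((-1) * e + x) in X1, E1 by ring.
  replace (x + r) with (1 * r + x) in X2, E2 by ring.
  replace (x + e) with (1 * e + x) in X2, E2 by ring.
  set (f1 := fun s => -1 * f (-1 * s + x)).
  set (f2 := fun s => 1 * f (1 * s + x)).
  assert (Y1 : ex_RInt f1 e r) by apply ex_RInt_swap, (ex_RInt_comp_lin f (-1) x r e X1).
  assert (Y2 : ex_RInt f2 e r) by exact (ex_RInt_comp_lin f 1 x e r X2).
  assert (G1 : RInt f1 r e = I1) by (rewrite <- E1; exact (RInt_comp_lin f (-1) x r e X1)).
  assert (G2 : RInt f2 e r = I2) by (rewrite <- E2; exact (RInt_comp_lin f 1 x e r X2)).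
  rewrite <- (opp_RInt_swap f1 e r Y1), <- (RInt_opp f1 e r Y1) in G1.
  assert (E : RInt (fun s => (A (x - s) - A (x + s)) / s) e r = I1 + I2).
  { rewrite <- G1, <- G2.
    change (?a + ?b) with (plus a b).
    rewrite <- (RInt_plus (V := R_CompleteNormedModule));
      [| apply (ex_RInt_opp _ _ _ Y1) | exact Y2].
    apply RInt_ext. intros s _. unfold f1, f2, f.
    replace (x - (-1 * s + x)) with s by ring.
    replace (x - (1 * s + x)) with (- s) by ring.
    replace (-1 * s + x) with (x - s) by ring.
    replace (1 * s + x) with (x + s) by ring.
    unfold plus, opp, scal; simpl. unfold mult; simpl.
    unfold Rdiv. rewrite Rinv_opp. ring. }
  rewrite E. exact Hlt.
Qed.

(** The last clause stands for concavity on the positive axis: beyond [x] the slopes are at most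
    [m x / x], hence at most [B / x]. It is stable enough to cover [m] and [atan] at once and
    mentions no derivative. *)
Definition odd_profile (m : R -> R) (B : R) : Prop :=
  (forall x, m (- x) = - m x) /\
  (forall x, 0 <= x -> 0 <= m x <= B) /\
  (forall x y, 0 <= x -> x <= y -> m x <= m y) /\
  (forall x y, 0 < x -> x <= y -> m y - m x <= (y - x) * (B / x)).

(** By the mean value theorem a chord over [[x, y]] has slope [f b] with [b > x], and the chord over
    [[0, x]] has slope [f a = m x / x] with [a < x]; since [f] decreases,
    [f b <= m x / x <= B / x]. *)
Lemma odd_profile_of_derive (m f : R -> R) (B : R) :
  continuity m -> (forall x, m (- x) = - m x) ->
  (forall x, 0 < x -> derivable_pt_lim m x (f x)) ->
  (forall x, 0 < x -> 0 <= f x) ->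
  (forall x y, 0 < x -> x <= y -> f y <= f x) ->
  (forall x, 0 <= x -> m x <= B) ->
  odd_profile m B.
Proof.
  intros Hc Hodd Hd Hf Hdec HB.
  assert (m0 : m 0 = 0).
  { specialize (Hodd 0). rewrite Ropp_0 in Hodd. lra. }
  assert (Hmono : forall x y, 0 <= x -> x <= y -> m x <= m y).
  { intros x y Hx Hxy. apply (le_of_derive_nonneg m f); auto.
    - intros z Hz. apply Hd. lra.
    - intros z Hz. apply Hf. lra. }
  repeat split; auto.
  - rewrite <- m0. auto with real.
  - intros x y Hx Hxy.
    destruct (Req_dec x y) as [->|Hne]; [rewrite !Rminus_diag, Rmult_0_l; lra|].
    destruct (MVT_open m f 0 x) as [a [Ha Ea]]; auto.
    { intros z Hz. apply Hd. lra. }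
    destruct (MVT_open m f x y) as [b [Hb Eb]]; auto; [lra| |].
    { intros z Hz. apply Hd. lra. }
    assert (f b <= f a) by (apply Hdec; lra).
    rewrite Eb. rewrite Rmult_comm. apply Rmult_le_compat_l; [lra|].
    apply (Rmult_le_reg_r x); auto.
    replace (B / x * x) with B by (field; lra).
    specialize (HB x). nra.
Qed.

(** For [r <= t / 2] both points lie beyond [t / 2], where slopes are at most [2 B / t]. For larger
    [r] the total oscillation [B] is already below [4 B r / t]. *)
Lemma odd_profile_near (m : R -> R) (B t r : R) :
  odd_profile m B -> 0 < r < t ->
  Rabs ((m (t - r) - m (t + r)) / r) <= 4 * B / t.
Proof.
  intros (Hodd & Hb & Hmono & Hstar) Hr.
  assert (HB : 0 <= B) by (specialize (Hb 0); lra).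
  assert (H1 : m (t - r) <= m (t + r)) by (apply Hmono; lra).
  assert (Hkey : m (t + r) - m (t - r) <= 4 * B / t * r).
  { destruct (Rle_dec r (t / 2)) as [Hle|Hgt].
    - eapply Rle_trans; [apply Hstar; lra|].
      replace (t + r - (t - r)) with (2 * r) by ring.
      replace (4 * B / t * r) with (2 * r * (B * / (t / 2))) by (field; lra).
      apply Rmult_le_compat_l; [lra|]. apply Rmult_le_compat_l; auto.
      apply Rinv_le_contravar; lra.
    - apply Rle_trans with B.
      + assert (0 <= m (t - r) <= B) by (apply Hb; lra).
        assert (0 <= m (t + r) <= B) by (apply Hb; lra). lra.
      + apply (Rmult_le_reg_r t); [lra|].
        replace (4 * B / t * r * t) with (4 * B * r) by (field; lra). nra. }
  unfold Rdiv. rewrite Rabs_mult, (Rabs_left1 (_ - _)), (Rabs_right (/ r)) by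
    (try lra; apply Rle_ge, Rlt_le, Rinv_0_lt_compat; lra).
  apply (Rmult_le_reg_r r); [lra|].
  rewrite Rmult_assoc, Rinv_l by lra.
  unfold Rdiv in Hkey. lra.
Qed.

(** By oddness the numerator is [- (m (r - t) + m (r + t))]. Its distance to [- 2 m r] is the
    difference of two increments of [m] over length [t], each in [[0, 2 B t / r]], so the two errors
    do not add up. *)
Lemma odd_profile_far (m : R -> R) (B t r : R) :
  odd_profile m B -> 0 < t < r ->
  Rabs ((m (t - r) - m (t + r)) / r + 2 * (m r / r)) <= 2 * B * t / (r * r).
Proof.
  intros (Hodd & Hb & Hmono & Hstar) Hr.
  assert (HB : 0 <= B) by (specialize (Hb 0); lra).
  assert (H1 : m (r - t) <= m r) by (apply Hmono; lra).
  assert (H2 : m r <= m (r + t)) by (apply Hmono; lra).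
  assert (K1 : m r - m (r - t) <= 2 * B * t / r).
  { destruct (Rle_dec r (2 * t)) as [Hle|Hgt].
    - apply Rle_trans with B.
      + assert (0 <= m (r - t) <= B) by (apply Hb; lra).
        assert (0 <= m r <= B) by (apply Hb; lra). lra.
      + apply (Rmult_le_reg_r r); [lra|].
        replace (2 * B * t / r * r) with (2 * B * t) by (field; lra). nra.
    - eapply Rle_trans; [apply Hstar; lra|].
      replace (r - (r - t)) with t by ring.
      replace (2 * B * t / r) with (t * (B * / (r / 2))) by (field; lra).
      apply Rmult_le_compat_l; [lra|]. apply Rmult_le_compat_l; auto.
      apply Rinv_le_contravar; lra. }
  assert (K2 : m (r + t) - m r <= 2 * B * t / r).
  { eapply Rle_trans; [apply Hstar; lra|].
    replace (r + t - r) with t by ring.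
    apply (Rmult_le_reg_r r); [lra|].
    replace (2 * B * t / r * r) with (2 * B * t) by (field; lra).
    replace (t * (B / r) * r) with (B * t) by (field; lra). nra. }
  replace (t - r) with (- (r - t)) by ring. rewrite Hodd.
  replace (t + r) with (r + t) by ring.
  replace ((- m (r - t) - m (r + t)) / r + 2 * (m r / r))
    with (((m r - m (r - t)) - (m (r + t) - m r)) * / r) by (field; lra).
  replace (2 * B * t / (r * r)) with (2 * B * t / r * / r) by (field; lra).
  assert (0 < / r) by (apply Rinv_0_lt_compat; lra).
  rewrite Rabs_mult, (Rabs_right (/ r)) by lra.
  apply Rmult_le_compat_r; [lra|]. apply Rabs_le. lra.
Qed.

Lemma Rabs_minus_scal_le (a b x y k : R) :
  0 <= k -> Rabs a <= x -> Rabs b <= y -> Rabs (a - k * b) <= x + k * y.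
Proof.
  intros Hk Ha Hb. unfold Rminus. eapply Rle_trans; [apply Rabs_triang|].
  rewrite Rabs_Ropp, Rabs_mult, (Rabs_right k) by lra.
  apply Rplus_le_compat; auto. apply Rmult_le_compat_l; auto.
Qed.

(** With [B = B1 + k * B2], the near bound [4 B / t] over a length at most [t] gives [4 B], and the
    far bound [2 B t / s^2] integrated from [t] on gives [2 B]. The estimates are applied to [m1]
    and [m2] separately, since the difference [A] need not be a profile. *)
Lemma symmetric_integral_tail (m1 m2 : R -> R) (k B1 B2 e t r : R) :
  continuity m1 -> continuity m2 ->
  odd_profile m1 B1 -> odd_profile m2 B2 -> 0 <= k ->
  0 < e < t -> t < r ->
  let A := fun y => m1 y - k * m2 y in
  Rabs (RInt (fun s => (A (t - s) - A (t + s)) / s) e r + 2 * RInt (fun s => A s / s) t r)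
    <= 6 * (B1 + k * B2).
Proof.
  intros C1 C2 P1 P2 Hk He Hr A.
  set (B := B1 + k * B2).
  assert (HB : 0 <= B).
  { destruct P1 as (_ & Hb1 & _), P2 as (_ & Hb2 & _).
    specialize (Hb1 0). specialize (Hb2 0). unfold B. nra. }
  assert (CA : forall x, continuity_pt A x).
  { intros x. unfold A. apply (continuity_pt_minus m1); [apply C1|].
    apply (continuity_pt_scal m2), C2. }
  assert (Cinv : forall s, 0 < s -> continuity_pt (fun s => / s) s).
  { intros s Hs. apply (continuity_pt_inv id); [apply derivable_continuous_pt, derivable_pt_id|].
    unfold id; lra. }
  assert (CD : forall s, 0 < s -> continuity_pt (fun s => (A (t - s) - A (t + s)) / s) s).
  { intros s Hs. apply (continuity_pt_mult (fun s => A (t - s) - A (t + s))); auto.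
    apply (continuity_pt_minus (fun s => A (t - s))).
    - apply (continuity_pt_comp (fun s => t - s) A); auto.
      apply derivable_continuous_pt. reg.
    - apply (continuity_pt_comp (fun s => t + s) A); auto.
      apply derivable_continuous_pt. reg. }
  assert (CE : forall s, 0 < s -> continuity_pt (fun s => A s / s) s).
  { intros s Hs. apply (continuity_pt_mult A); auto. }
  set (D := fun s => (A (t - s) - A (t + s)) / s) in *.
  assert (XD : forall a b, 0 < a -> a <= b -> ex_RInt D a b).
  { intros a b Ha Hab. apply ex_RInt_of_continuity; auto. intros s Hs. apply CD. lra. }
  assert (XE : ex_RInt (fun s => A s / s) t r).
  { apply ex_RInt_of_continuity; [lra|]. intros s Hs. apply CE. lra. }
  assert (Esplit : RInt D e r = RInt D e t + RInt D t r).
  { symmetry. apply (RInt_Chasles D); apply XD; lra. }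
  assert (Eadd : RInt D t r + 2 * RInt (fun s => A s / s) t r
                 = RInt (fun s => D s + 2 * (A s / s)) t r).
  { change (2 * RInt (fun s => A s / s) t r) with (scal 2 (RInt (fun s => A s / s) t r)).
    rewrite <- (RInt_scal (V := R_CompleteNormedModule)) by exact XE.
    change (RInt D t r + ?z) with (plus (RInt D t r) z).
    rewrite <- (RInt_plus (V := R_CompleteNormedModule));
      [reflexivity | apply XD; lra | apply (ex_RInt_scal (V := R_NormedModule)), XE]. }
  assert (Bnear : Rabs (RInt D e t) <= 4 * B).
  { eapply Rle_trans.
    - apply (RInt_abs_le_primitive D (fun _ => 4 * B / t) (fun s => 4 * B / t * s)); [lra| | | |].
      + intros s Hs. apply CD. lra.
      + intros s _. apply is_derive_Reals. auto_derive; [exact I | ring].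
      + intros s _. apply continuity_pt_const. intros ? ?; reflexivity.
      + intros s Hs. unfold D, A.
        replace ((m1 (t - s) - k * m2 (t - s) - (m1 (t + s) - k * m2 (t + s))) / s)
          with ((m1 (t - s) - m1 (t + s)) / s - k * ((m2 (t - s) - m2 (t + s)) / s))
          by (field; lra).
        replace (4 * B / t) with (4 * B1 / t + k * (4 * B2 / t)) by (unfold B; field; lra).
        apply Rabs_minus_scal_le; auto; apply odd_profile_near; auto; lra.
    - replace (4 * B / t * t - 4 * B / t * e) with (4 * B - 4 * B / t * e) by (field; lra).
      assert (0 <= 4 * B / t * e); [|lra].
      apply Rmult_le_pos; [|lra]. apply Rmult_le_pos; [lra|].
      apply Rlt_le, Rinv_0_lt_compat; lra. }
  assert (Bfar : Rabs (RInt (fun s => D s + 2 * (A s / s)) t r) <= 2 * B).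
  { eapply Rle_trans.
    - apply (RInt_abs_le_primitive _ (fun s => 2 * B * t / (s * s)) (fun s => - (2 * B * t) * / s));
        [lra| | | |].
      + intros s Hs. apply (continuity_pt_plus D); [apply CD; lra|].
        apply (continuity_pt_scal (fun s => A s / s)), CE. lra.
      + intros s Hs. apply is_derive_Reals. auto_derive; [lra|]. field. lra.
      + intros s Hs. apply derivable_continuous_pt. reg. nra.
      + intros s Hs. unfold D, A.
        replace ((m1 (t - s) - k * m2 (t - s) - (m1 (t + s) - k * m2 (t + s))) / s
                 + 2 * ((m1 s - k * m2 s) / s))
          with (((m1 (t - s) - m1 (t + s)) / s + 2 * (m1 s / s))
                - k * ((m2 (t - s) - m2 (t + s)) / s + 2 * (m2 s / s)))
          by (field; lra).
        replace (2 * B * t / (s * s)) with (2 * B1 * t / (s * s) + k * (2 * B2 * t / (s * s)))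
          by (unfold B; field; lra).
        apply Rabs_minus_scal_le; auto; apply odd_profile_far; auto; lra.
    - replace (- (2 * B * t) * / r - - (2 * B * t) * / t) with (2 * B - 2 * B * t * / r)
        by (field; lra).
      assert (0 <= 2 * B * t * / r); [|lra].
      apply Rmult_le_pos; [nra|]. apply Rlt_le, Rinv_0_lt_compat; lra. }
  rewrite Esplit.
  replace (RInt D e t + RInt D t r + 2 * RInt (fun s => A s / s) t r)
    with (RInt D e t + RInt (fun s => D s + 2 * (A s / s)) t r) by (rewrite <- Eadd; ring).
  eapply Rle_trans; [apply Rabs_triang|]. lra.
Qed.

(** * The arctangent profile and its logarithmic primitive *)

(** Once [F 0 = - (mu - nu) * PI / 2] is known, this turns [F - (mu - nu) * theta] into a difference
    of two odd profiles. *)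
Lemma theta_atan (x : R) : theta x = atan x - PI / 2.
Proof.
  unfold theta. destruct (Rlt_dec 0 x) as [Hx|Hx].
  - rewrite atan_opp, atan_inv by lra. ring.
  - destruct (Req_EM_T x 0) as [->|Hne].
    + rewrite atan_0. ring.
    + replace (- / x) with (/ - x) by (field; lra).
      rewrite atan_inv, atan_opp by lra. lra.
Qed.

Lemma continuity_atan : continuity atan.
Proof. intros x. apply derivable_continuous_pt, derivable_pt_atan. Qed.

Lemma atan_odd_profile : odd_profile atan (PI / 2).
Proof.
  apply (odd_profile_of_derive atan (fun x => / (1 + x ^ 2))).
  - apply continuity_atan.
  - apply atan_opp.
  - intros x _. apply derivable_pt_lim_atan.
  - intros x _. apply Rlt_le, Rinv_0_lt_compat. nra.
  - intros x y Hx Hxy. apply Rinv_le_contravar; nra.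
  - intros x _. apply Rlt_le, atan_bound.
Qed.

Lemma atan_le_id (x : R) : 0 <= x -> atan x <= x.
Proof.
  intros Hx.
  enough (0 - atan 0 <= x - atan x) by (rewrite atan_0 in *; lra).
  apply (le_of_derive_nonneg (fun x => x - atan x) (fun x => 1 - / (1 + x ^ 2))); auto.
  - intros y _. apply derivable_pt_lim_minus; [apply derivable_pt_lim_id | apply derivable_pt_lim_atan].
  - intros y _. apply derivable_continuous_pt, derivable_pt_minus;
      [apply derivable_pt_id | apply derivable_pt_atan].
  - intros y Hy. enough (/ (1 + y ^ 2) <= / 1) by (rewrite Rinv_1 in *; lra).
    apply Rinv_le_contravar; nra.
Qed.

(** The two terms are the derivatives of [(2 / PI)] times the primitive of [atan s / s] and of
    [ln (1 + r^2) / 2]; both lie in [[0, 1]]. *)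
Lemma dlog_atan_small (r : R) : 0 < r ->
  Rabs (2 / PI * (atan r / r) - r / (1 + r ^ 2)) <= 1.
Proof.
  intros Hr. assert (HPI := PI_RGT_0). assert (H3 := PI2_3_2).
  assert (Ha : 0 < atan r) by (rewrite <- atan_0; apply atan_increasing; auto).
  assert (Hi := atan_le_id r (Rlt_le _ _ Hr)).
  assert (0 <= atan r / r <= 1).
  { split; [apply Rlt_le, Rdiv_lt_0_compat; auto|].
    apply (Rmult_le_reg_r r); auto. unfold Rdiv. rewrite Rmult_assoc, Rinv_l; lra. }
  assert (0 <= 2 / PI <= 1).
  { split; [apply Rlt_le, Rdiv_lt_0_compat; lra|].
    apply (Rmult_le_reg_r PI); auto. unfold Rdiv. rewrite Rmult_assoc, Rinv_l; lra. }
  assert (0 <= r / (1 + r ^ 2) <= 1).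
  { split; [apply Rlt_le, Rdiv_lt_0_compat; nra|].
    apply (Rmult_le_reg_r (1 + r ^ 2)); [nra|]. unfold Rdiv. rewrite Rmult_assoc, Rinv_l; nra. }
  apply Rabs_le. nra.
Qed.

(** After factoring out [/ r], what remains is a difference of [/ (1 + r^2)] and
    [(2 / PI) * atan (/ r)], both in [[0, / r]]. *)
Lemma dlog_atan_large (r : R) : 0 < r ->
  Rabs (2 / PI * (atan r / r) - r / (1 + r ^ 2)) <= / (r * r).
Proof.
  intros Hr. assert (HPI := PI_RGT_0). assert (H3 := PI2_3_2).
  assert (Hri : 0 < / r) by (apply Rinv_0_lt_compat; auto).
  assert (Hi := atan_le_id (/ r) (Rlt_le _ _ Hri)). rewrite atan_inv in Hi by auto.
  assert (Hb := atan_bound r).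
  assert (Hc : 0 <= 2 / PI <= 1).
  { split; [apply Rlt_le, Rdiv_lt_0_compat; lra|].
    apply (Rmult_le_reg_r PI); auto. unfold Rdiv. rewrite Rmult_assoc, Rinv_l; lra. }
  assert (E : 2 / PI * (atan r / r) - r / (1 + r ^ 2)
     = / r * (/ (1 + r ^ 2) - 2 / PI * (PI / 2 - atan r))) by (field; repeat split; nra).
  rewrite E, Rabs_mult, (Rabs_right (/ r)), Rinv_mult by lra.
  apply Rmult_le_compat_l; [lra|].
  assert (0 < / (1 + r ^ 2) <= / r).
  { split; [apply Rinv_0_lt_compat; nra|]. apply Rinv_le_contravar; nra. }
  apply Rabs_le. nra.
Qed.

(** The base point [1] avoids [0], where integrands such as [m s / s] need not be continuous. *)
Lemma RInt_from_1_derive (f : R -> R) (x : R) :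
  (forall y, 0 < y -> continuity_pt f y) -> 0 < x ->
  derivable_pt_lim (RInt f 1) x (f x).
Proof.
  intros Hf Hx. apply is_derive_Reals.
  apply (is_derive_RInt f (RInt f 1) 1 x).
  - exists (mkposreal x Hx). intros y Hy.
    apply (RInt_correct (V := R_CompleteNormedModule)).
    apply (ex_RInt_continuous (V := R_CompleteNormedModule)).
    intros z Hz. apply continuity_pt_continuous, Hf.
    assert (0 < y).
    { apply Rabs_def2 in Hy. unfold minus, plus, opp in Hy; simpl in Hy. lra. }
    enough (0 < Rmin 1 y) by lra. apply Rmin_pos; lra.
  - apply continuity_pt_continuous, Hf, Hx.
Qed.

Lemma continuity_pt_div_id (f : R -> R) (x : R) :
  continuity f -> 0 < x -> continuity_pt (fun s => f s / s) x.
Proof.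
  intros Hf Hx. apply (continuity_pt_mult f); [apply Hf|].
  apply (continuity_pt_inv id); [apply derivable_continuous_pt, derivable_pt_id|].
  unfold id; lra.
Qed.

(** The difference [V] vanishes at [1], and its derivative is bounded by [1] on [(0, 1]] and by
    [/ r^2] beyond; each bound has integral [1]. The comparison functions [t] and [- / t] are
    primitives of these bounds. *)
Lemma atan_primitive_log (t : R) : 0 < t ->
  Rabs (2 / PI * RInt (fun s => atan s / s) 1 t - (ln (t ^ 2 + 1) - ln 2) / 2) <= 1.
Proof.
  intros Ht.
  set (V := fun t => 2 / PI * RInt (fun s => atan s / s) 1 t - (ln (t ^ 2 + 1) - ln 2) / 2).
  set (v := fun r => 2 / PI * (atan r / r) - r / (1 + r ^ 2)).
  assert (DV : forall r, 0 < r -> derivable_pt_lim V r (v r)).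
  { intros r Hr. apply derivable_pt_lim_minus.
    - apply derivable_pt_lim_scal, (RInt_from_1_derive (fun s => atan s / s)); auto.
      intros y Hy. apply continuity_pt_div_id; auto.
      apply continuity_atan.
    - apply is_derive_Reals. auto_derive; [nra|]. field. nra. }
  assert (V1 : V 1 = 0).
  { unfold V. replace (1 ^ 2 + 1) with 2 by ring.
    rewrite RInt_point. unfold zero; simpl. lra. }
  change (Rabs (V t) <= 1).
  destruct (Rle_dec t 1) as [H1|H1].
  - assert (A1 : V t + t <= V 1 + 1).
    { apply (le_of_derive_nonneg (fun t => V t + t) (fun r => v r + 1)); auto.
      - intros x Hx. apply derivable_pt_lim_plus; [apply DV; lra | apply derivable_pt_lim_id].
      - intros x Hx. eapply derivable_pt_lim_continuity_pt.
        apply derivable_pt_lim_plus; [apply DV; lra | apply derivable_pt_lim_id].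
      - intros x Hx. assert (H := dlog_atan_small x). unfold v.
        apply Rabs_le_between in H; lra. }
    assert (A2 : t - V t <= 1 - V 1).
    { apply (le_of_derive_nonneg (fun t => t - V t) (fun r => 1 - v r)); auto.
      - intros x Hx. apply derivable_pt_lim_minus; [apply derivable_pt_lim_id | apply DV; lra].
      - intros x Hx. eapply derivable_pt_lim_continuity_pt.
        apply derivable_pt_lim_minus; [apply derivable_pt_lim_id | apply DV; lra].
      - intros x Hx. assert (H := dlog_atan_small x). unfold v.
        apply Rabs_le_between in H; lra. }
    apply Rabs_le. lra.
  - assert (Di : forall x, 0 < x -> derivable_pt_lim (fun x => - / x) x (/ (x * x))).
    { intros x Hx. apply is_derive_Reals. auto_derive; [lra|]. field. lra. }
    assert (0 < / t) by (apply Rinv_0_lt_compat; lra).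
    assert (A1 : V 1 + - / 1 <= V t + - / t).
    { apply (le_of_derive_nonneg (fun t => V t + - / t) (fun r => v r + / (r * r))); [lra | | |].
      - intros x Hx. apply derivable_pt_lim_plus; [apply DV; lra | apply Di; lra].
      - intros x Hx. eapply derivable_pt_lim_continuity_pt.
        apply derivable_pt_lim_plus; [apply DV; lra | apply Di; lra].
      - intros x Hx. assert (H2 := dlog_atan_large x). unfold v.
        apply Rabs_le_between in H2; lra. }
    assert (A2 : - / 1 - V 1 <= - / t - V t).
    { apply (le_of_derive_nonneg (fun t => - / t - V t) (fun r => / (r * r) - v r)); [lra | | |].
      - intros x Hx. apply derivable_pt_lim_minus; [apply Di; lra | apply DV; lra].
      - intros x Hx. eapply derivable_pt_lim_continuity_pt.
        apply derivable_pt_lim_minus; [apply Di; lra | apply DV; lra].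
      - intros x Hx. assert (H2 := dlog_atan_large x). unfold v.
        apply Rabs_le_between in H2; lra. }
    rewrite Rinv_1 in *. apply Rabs_le. lra.
Qed.

(** * From the Hilbert transform to logarithmic primitives *)

(** The two profile bounds add up to [PI * al], whence [6 * PI * al]; the extra [PI] is the
    tolerance [1] taken in the principal value. The cut-off [r] stays free, so that different points
    can share it. *)
Lemma hilbert_tail (m g : R -> R) (al : R) :
  0 <= al -> continuity m -> odd_profile m (al * (PI / 2)) ->
  let A := fun y => m y - al * atan y in
  (forall x, hilbert_pv A x (g x)) ->
  forall t, 0 < t -> exists M, forall r, M < r -> t < r ->
    Rabs (PI * g t + 2 * RInt (fun s => A s / s) t r) <= 6 * PI * al + PI.
Proof.
  intros Hal Hm Pm A Hh t Ht. assert (HPI := PI_RGT_0).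
  destruct (hilbert_pv_symmetric A t (g t) (Hh t) 1 Rlt_0_1) as (d & M & Hd & HM & Hint).
  exists M. intros r Hr Htr.
  set (e := Rmin d t / 2).
  assert (He : 0 < e < d /\ e < t).
  { unfold e. assert (0 < Rmin d t) by (apply Rmin_pos; auto).
    assert (Rmin d t <= d) by apply Rmin_l. assert (Rmin d t <= t) by apply Rmin_r. lra. }
  specialize (Hint e r (proj1 He) Hr).
  assert (T := symmetric_integral_tail m atan al _ _ e t r Hm
    continuity_atan Pm atan_odd_profile Hal
    (conj (proj1 (proj1 He)) (proj2 He)) Htr).
  cbv zeta in T. fold A in T.
  set (I := RInt (fun s => (A (t - s) - A (t + s)) / s) e r) in *.
  change (Rabs (I + 2 * RInt (fun s => A s / s) t r) <=
          6 * (al * (PI / 2) + al * (PI / 2))) in T.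
  assert (HI : Rabs (I - PI * g t) <= PI).
  { replace (I - PI * g t) with (PI * (I / PI - g t)) by (field; lra).
    rewrite Rabs_mult, (Rabs_right PI) by lra. nra. }
  apply Rabs_le_between in HI, T. apply Rabs_le. lra.
Qed.

(** Subtracting the tail estimates at [s] and [t] with a common [r] leaves the integral of [A / r]
    between [s] and [t]. Its [atan] part is the logarithm in [G] up to [2 * al], and the two tails
    cost [2 * (6 * al + 1)]. *)
Lemma hilbert_increment (m g : R -> R) (al s t : R) :
  0 <= al -> continuity m -> odd_profile m (al * (PI / 2)) ->
  (forall x, hilbert_pv (fun y => m y - al * atan y) x (g x)) ->
  0 < s -> 0 < t ->
  let G := fun x => g x + al / 2 * ln (x ^ 2 + 1) in
  let J := fun x => 2 / PI * RInt (fun r => m r / r) 1 x in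
  Rabs (G t - G s - (J t - J s)) <= 14 * al + 2.
Proof.
  intros Hal Hm Pm Hh Hs Ht G J. assert (HPI := PI_RGT_0).
  destruct (hilbert_tail m g al Hal Hm Pm Hh s Hs) as [Ms Ks].
  destruct (hilbert_tail m g al Hal Hm Pm Hh t Ht) as [Mt Kt].
  set (A := fun y => m y - al * atan y) in *.
  set (r := Rmax (Rmax Ms Mt) (Rmax s t) + 1).
  assert (Ms < r /\ Mt < r /\ s < r /\ t < r).
  { unfold r. assert (H1 := Rmax_l (Rmax Ms Mt) (Rmax s t)).
    assert (H2 := Rmax_r (Rmax Ms Mt) (Rmax s t)).
    assert (H3 := Rmax_l Ms Mt). assert (H4 := Rmax_r Ms Mt).
    assert (H5 := Rmax_l s t). assert (H6 := Rmax_r s t). lra. }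
  specialize (Ks r). specialize (Kt r).
  assert (Catan : continuity atan) by apply continuity_atan.
  assert (CA : continuity A).
  { apply continuity_minus; auto. apply continuity_scal; auto. }
  assert (EA : forall x, 0 < x -> x < r ->
     RInt (fun s => A s / s) x r =
       (RInt (fun s => m s / s) 1 r - al * RInt (fun s => atan s / s) 1 r)
       - (RInt (fun s => m s / s) 1 x - al * RInt (fun s => atan s / s) 1 x)).
  { intros x Hx Hxr.
    apply (RInt_primitive (fun x => RInt (fun s => m s / s) 1 x
                                   - al * RInt (fun s => atan s / s) 1 x)); [lra| |].
    - intros y Hy. unfold A.
      replace ((m y - al * atan y) / y) with (m y / y - al * (atan y / y)) by (field; lra).
      apply derivable_pt_lim_minus; [|apply derivable_pt_lim_scal].
      + apply (RInt_from_1_derive (fun s => m s / s)); [|lra].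
        intros; apply continuity_pt_div_id; auto.
      + apply (RInt_from_1_derive (fun s => atan s / s)); [|lra].
        intros; apply continuity_pt_div_id; auto.
    - intros y Hy. apply continuity_pt_div_id; auto. lra. }
  change (fun s : R => (m s - al * atan s) / s) with (fun s => A s / s) in *.
  rewrite EA in Ks, Kt by lra.
  assert (Ls := atan_primitive_log s Hs). assert (Lt := atan_primitive_log t Ht).
  unfold G, J.
  pose (Im := fun x => RInt (fun s => m s / s) 1 x).
  pose (Ia := fun x => RInt (fun s => atan s / s) 1 x).
  change (RInt (fun s => m s / s) 1 ?x) with (Im x) in Ks, Kt |- *.
  change (RInt (fun s => atan s / s) 1 ?x) with (Ia x) in Ks, Kt, Ls, Lt.
  assert (Kst : Rabs (PI * (g t - g s) - 2 * ((Im t - al * Ia t) - (Im s - al * Ia s)))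
                <= 2 * (6 * PI * al + PI)).
  { assert (Ks' := Ks ltac:(lra) ltac:(lra)). assert (Kt' := Kt ltac:(lra) ltac:(lra)).
    apply Rabs_le_between in Ks', Kt'. apply Rabs_le. lra. }
  assert (K2 : Rabs (g t - g s - 2 / PI * ((Im t - al * Ia t) - (Im s - al * Ia s)))
                <= 2 * (6 * al + 1)).
  { apply (Rmult_le_reg_l PI); auto.
    rewrite <- (Rabs_right PI) at 1 by lra. rewrite <- Rabs_mult.
    replace (PI * (g t - g s - 2 / PI * (Im t - al * Ia t - (Im s - al * Ia s))))
      with (PI * (g t - g s) - 2 * ((Im t - al * Ia t) - (Im s - al * Ia s))) by (field; lra).
    lra. }
  replace (g t + al / 2 * ln (t ^ 2 + 1) - (g s + al / 2 * ln (s ^ 2 + 1))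
           - (2 / PI * Im t - 2 / PI * Im s))
    with ((g t - g s - 2 / PI * ((Im t - al * Ia t) - (Im s - al * Ia s)))
          - al * ((2 / PI * Ia t - (ln (t ^ 2 + 1) - ln 2) / 2)
                  - (2 / PI * Ia s - (ln (s ^ 2 + 1) - ln 2) / 2))) by (field; lra).
  replace (14 * al + 2) with (2 * (6 * al + 1) + al * 2) by ring.
  apply Rabs_minus_scal_le; auto.
  apply Rabs_le_between in Ls, Lt. apply Rabs_le. lra.
Qed.

(** At the point [0] oddness makes the symmetric integrand [-2 * A s / s]. The Cauchy criterion for
    the principal value there bounds the integral of [A s / s] over [[t, r]] for all large [t], and
    [hilbert_tail] then bounds [g t]. *)
Lemma hilbert_bound_at_infinity (m g : R -> R) (al : R) :
  0 <= al -> continuity m -> odd_profile m (al * (PI / 2)) ->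
  (forall x, hilbert_pv (fun y => m y - al * atan y) x (g x)) ->
  exists M, forall t, M < t -> Rabs (g t) <= 6 * al + 3.
Proof.
  intros Hal Hm Pm Hh. assert (HPI := PI_RGT_0).
  assert (Catan : continuity atan) by apply continuity_atan.
  set (A := fun y => m y - al * atan y) in *.
  assert (CA : continuity A).
  { apply continuity_minus; auto. apply continuity_scal; auto. }
  assert (CI : forall y, 0 < y -> continuity_pt (fun s => A s / s) y).
  { intros; apply continuity_pt_div_id; auto. }
  destruct (hilbert_pv_symmetric A 0 (g 0) (Hh 0) 1 Rlt_0_1) as (d & M & Hd & HM & Hint).
  exists M. intros t HMt.
  destruct (hilbert_tail m g al Hal Hm Pm Hh t) as [Mt Kt]; [lra|].
  set (r := Rmax Mt t + 1).
  assert (Hr : Mt < r /\ t < r).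
  { unfold r. assert (H1 := Rmax_l Mt t). assert (H2 := Rmax_r Mt t). lra. }
  specialize (Kt r (proj1 Hr) (proj2 Hr)).
  change (fun s : R => (m s - al * atan s) / s) with (fun s => A s / s) in *.
  set (e := Rmin d t / 2).
  assert (He : 0 < e < d /\ e < t).
  { unfold e. assert (0 < Rmin d t) by (apply Rmin_pos; lra).
    assert (Rmin d t <= d) by apply Rmin_l. assert (Rmin d t <= t) by apply Rmin_r. lra. }
  assert (Eodd : forall b, e < b ->
     RInt (fun s => (A (0 - s) - A (0 + s)) / s) e b = -2 * RInt (fun s => A s / s) e b).
  { intros b Hb.
    change (-2 * RInt (fun s => A s / s) e b) with (scal (-2) (RInt (fun s => A s / s) e b)).
    rewrite <- (RInt_scal (V := R_CompleteNormedModule)).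
    - apply RInt_ext. intros s _. unfold scal; simpl. unfold mult; simpl. unfold A.
      destruct Pm as (Hodd & _).
      rewrite Rminus_0_l, Rplus_0_l, Hodd, atan_opp. unfold Rdiv. ring.
    - apply ex_RInt_of_continuity; [lra|]. intros x Hx. apply CI. lra. }
  assert (H1 := Hint e t (proj1 He) HMt).
  assert (H2 := Hint e r (proj1 He) ltac:(lra)).
  rewrite Eodd in H1, H2 by lra.
  assert (Ech : RInt (fun s => A s / s) e r
                = RInt (fun s => A s / s) e t + RInt (fun s => A s / s) t r).
  { symmetry. apply (RInt_Chasles (V := R_CompleteNormedModule));
      apply ex_RInt_of_continuity; try lra; intros x Hx; apply CI; lra. }
  rewrite Ech in H2.
  set (X := RInt (fun s => A s / s) e t) in *.
  set (Y := RInt (fun s => A s / s) t r) in *.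
  (* The truncations at [t] and at [r] are both within [1] of [g 0]. *)
  assert (HY : Rabs (2 * Y) <= 2 * PI).
  { replace (2 * Y) with (PI * ((-2 * X / PI - g 0) - (-2 * (X + Y) / PI - g 0))) by (field; lra).
    rewrite Rabs_mult, (Rabs_right PI) by lra.
    rewrite (Rmult_comm 2 PI). apply Rmult_le_compat_l; [lra|].
    apply Rabs_def2 in H1, H2. apply Rabs_le. lra. }
  apply (Rmult_le_reg_l PI); auto.
  rewrite <- (Rabs_right PI) at 1 by lra. rewrite <- Rabs_mult.
  apply Rabs_le_between in HY, Kt. apply Rabs_le. lra.
Qed.

(** * Structure of the solutions *)

Lemma hinv_derive_exp (mu nu : R) (g : R -> R) (x : R) :
  Rpower (Rabs x) (nu - 1) * Rpower (x ^ 2 + 1) ((mu - nu) / 2) * exp (g x)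
  = exp ((nu - 1) * ln (Rabs x) + Gof mu nu g x).
Proof.
  unfold Rpower, Gof. rewrite <- !exp_plus. f_equal. ring.
Qed.

Lemma continuity_Gof (mu nu : R) (g : R -> R) :
  continuity g -> continuity (Gof mu nu g).
Proof.
  intros Hg x. apply (continuity_pt_plus g); [apply Hg|].
  apply derivable_pt_lim_continuity_pt with ((mu - nu) / 2 * (2 * x / (x ^ 2 + 1))).
  apply is_derive_Reals. auto_derive; [nra|]. field. nra.
Qed.

Lemma continuity_pt_ln_Rabs (x : R) : x <> 0 -> continuity_pt (fun y => ln (Rabs y)) x.
Proof.
  intros Hx. apply (continuity_pt_comp Rabs ln).
  - apply Rcontinuity_abs.
  - eapply derivable_pt_lim_continuity_pt, derivable_pt_lim_ln.
    apply Rabs_pos_lt, Hx.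
Qed.

(** The function [k y + k (- y)] has zero derivative for [y > 0] and vanishes at [0], where
    continuity suffices. *)
Lemma antisymmetric_of_even_derive (k d : R -> R) :
  continuity k -> k 0 = 0 ->
  (forall x, x <> 0 -> derivable_pt_lim k x (d x)) ->
  (forall x, x <> 0 -> d (- x) = d x) ->
  forall x, k (- x) = - k x.
Proof.
  intros Hc H0 Hd Heven.
  assert (Hpos : forall x, 0 < x -> k (- x) = - k x).
  { intros x Hx.
    destruct (MVT_open (fun y => k y + k (- y)) (fun y => d y + - d (- y)) 0 x Hx)
      as (c & Hc0 & E).
    - intros y Hy. apply derivable_pt_lim_plus; [apply Hd; lra|].
      apply derivable_pt_lim_reflect, Hd. lra.
    - intros y _. apply (continuity_pt_plus k); [apply Hc|].
      apply (continuity_pt_comp (fun y => - y) k); [|apply Hc].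
      apply derivable_continuous_pt. reg.
    - rewrite Heven, Ropp_0, H0 in E by lra. lra. }
  intros x. destruct (Rtotal_order x 0) as [Hx|[->|Hx]]; auto.
  - specialize (Hpos (- x)). rewrite Ropp_involutive in Hpos. lra.
  - rewrite Ropp_0. lra.
Qed.

(** Evenness of [G] makes [h] odd and [F'] even, so [m = F - F 0] is odd. From here on only the
    positive axis matters. *)
Lemma solution_structure (mu nu : R) (g : R -> R) :
  continuity g -> solves_312 mu nu g ->
  (forall x, Gof mu nu g (- x) = Gof mu nu g x) ->
  exists (kappa : R) (h m : R -> R),
    0 < kappa /\
    continuity h /\ h 0 = 0 /\
    (forall x, 0 < x -> derivable_pt_lim h x (exp ((nu - 1) * ln x + Gof mu nu g x))) /\
    continuity m /\ (forall x, m (- x) = - m x) /\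
    (forall x, 0 < x ->
       derivable_pt_lim m x (kappa / (h x * exp (nu * ln x + Gof mu nu g x)))) /\
    lim_pinf m ((mu - nu) * (PI / 2)) /\
    (forall x, hilbert_pv (fun y => m y - (mu - nu) * atan y) x (g x)).
Proof.
  intros Hg (h & kappa & F & Ch & h0 & Dh & Hk & Himp & CF & DF & LF & HH) Heven.
  set (G := Gof mu nu g) in *.
  pose (d := fun x => exp ((nu - 1) * ln (Rabs x) + G x)).
  pose (f := fun x => kappa / (x * h x * d x)).
  assert (Dh' : forall x, x <> 0 -> derivable_pt_lim h x (d x)).
  { intros x Hx. unfold d, G. rewrite <- hinv_derive_exp. apply Dh, Hx. }
  assert (DF' : forall x, x <> 0 -> derivable_pt_lim F x (f x)).
  { intros x Hx. unfold f, d, G. rewrite <- hinv_derive_exp. apply DF, Hx. }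
  replace (fun x => kappa / (x * h x *
         (Rpower (Rabs x) (nu - 1) * Rpower (x ^ 2 + 1) ((mu - nu) / 2)
          * exp (g x)))) with f in Himp.
  2:{ apply functional_extensionality. intros x. unfold f, d, G.
      rewrite hinv_derive_exp. reflexivity. }
  assert (CG : continuity G) by (apply continuity_Gof; auto).
  assert (deven : forall x, d (- x) = d x).
  { intros x. unfold d. rewrite Rabs_Ropp, Heven. reflexivity. }
  assert (hodd : forall x, h (- x) = - h x).
  { apply (antisymmetric_of_even_derive h d); auto. }
  assert (feven : forall x, f (- x) = f x).
  { intros x. unfold f. rewrite deven, hodd. f_equal. ring. }
  pose (m := fun x => F x - F 0).
  assert (Cm : continuity m).
  { apply continuity_minus; auto. apply continuity_const. intros ? ?; reflexivity. }
  assert (Dm : forall x, x <> 0 -> derivable_pt_lim m x (f x)).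
  { intros x Hx. replace (f x) with (f x - 0) by ring.
    apply derivable_pt_lim_minus; auto. apply derivable_pt_lim_const. }
  assert (m0 : m 0 = 0) by (unfold m; ring).
  assert (modd : forall x, m (- x) = - m x).
  { apply (antisymmetric_of_even_derive m f); auto. }
  assert (hpos : forall x, 0 < x -> 0 < h x).
  { intros x Hx. destruct (MVT_open h d 0 x Hx) as (c & Hc & E); auto.
    - intros y Hy. apply Dh'. lra.
    - assert (0 < d c) by apply exp_pos. rewrite h0 in E. nra. }
  assert (hne : forall x, x <> 0 -> h x <> 0).
  { intros x Hx. destruct (Rlt_dec 0 x) as [Hp|Hp].
    - specialize (hpos x Hp). lra.
    - assert (H := hpos (- x)). rewrite hodd in H. lra. }
  assert (Cf : forall x, x <> 0 -> continuity_pt f x).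
  { intros x Hx. apply (continuity_pt_mult (fun _ => kappa)).
    - apply continuity_pt_const. intros ? ?; reflexivity.
    - apply (continuity_pt_inv (fun x => x * h x * d x)).
      + apply (continuity_pt_mult (fun x => x * h x)).
        * apply (continuity_pt_mult id); [|apply Ch].
          apply derivable_continuous_pt, derivable_pt_id.
        * apply (continuity_pt_comp (fun x => (nu - 1) * ln (Rabs x) + G x) exp).
          -- apply (continuity_pt_plus (fun x => (nu - 1) * ln (Rabs x))); [|apply CG].
             apply (continuity_pt_scal (fun x => ln (Rabs x))), continuity_pt_ln_Rabs, Hx.
          -- apply derivable_continuous_pt, derivable_pt_exp.
      + assert (0 < d x) by apply exp_pos.
        repeat apply Rmult_integral_contrapositive_currified; auto. lra. }
  (* By oddness the truncated integral is [2 * (m b - m a)], which tends to [- 2 * F 0]. The five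
     shares of [eps] are one for the integral, two for [m a] and two for [F b]. *)
  assert (F0 : F 0 = - ((mu - nu) * (PI / 2))).
  { enough (Habs : Rabs (2 * F 0 + (mu - nu) * PI) <= 0).
    { assert (Habs' := Rabs_pos (2 * F 0 + (mu - nu) * PI)).
      assert (Hz : Rabs (2 * F 0 + (mu - nu) * PI) = 0) by lra.
      destruct (Req_dec (2 * F 0 + (mu - nu) * PI) 0) as [|Hne]; [lra|].
      apply Rabs_no_R0 in Hne. lra. }
    apply le_epsilon. intros eps Heps.
    destruct (Himp (eps / 5)) as (dl & M & Hdl & HM & Hint); [lra|].
    destruct (LF (eps / 5)) as (M' & HM'); [lra|].
    destruct (Cm 0 (eps / 5)) as (al & Hal & Hcont); [lra|].
    set (a := Rmin dl al / 2). set (b := Rmax (Rmax M M') a + 1).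
    assert (Ha : 0 < a < dl /\ a < al).
    { unfold a. assert (0 < Rmin dl al) by (apply Rmin_pos; lra).
      assert (Rmin dl al <= dl) by apply Rmin_l. assert (Rmin dl al <= al) by apply Rmin_r. lra. }
    assert (Hb : M < b /\ M' < b /\ a < b).
    { unfold b. assert (H1 := Rmax_l M M'). assert (H2 := Rmax_r M M').
      assert (H3 := Rmax_l (Rmax M M') a). assert (H4 := Rmax_r (Rmax M M') a). lra. }
    destruct (Hint a b a b) as (I1 & I2 & E1 & E2 & Hlt); try tauto.
    apply RInt_eq_RInt in E1, E2. destruct E1 as [_ E1], E2 as [_ E2].
    rewrite (RInt_primitive m f) in E1, E2; try lra;
      try (intros x Hx; (apply Dm || apply Cf); lra).
    rewrite !modd in E1.
    assert (Hma : Rabs (m a) < eps / 5).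
    { assert (H := Hcont a). simpl in H. unfold R_dist in H.
      rewrite m0, !Rminus_0_r in H. apply H. split; [split; [exact I | lra]|].
      rewrite Rabs_right; lra. }
    assert (HFb := HM' b ltac:(lra)). rewrite Rminus_0_r in HFb.
    rewrite <- E1, <- E2 in Hlt.
    apply Rabs_def2 in Hlt, Hma, HFb. unfold m in Hlt at 2 3.
    apply Rabs_le. unfold m in *. lra. }
  exists kappa, h, m. repeat split; auto.
  - intros x Hx. replace x with (Rabs x) at 2 by (apply Rabs_right; lra).
    apply Dh'. lra.
  - intros x Hx. replace (kappa / (h x * exp (nu * ln x + G x))) with (f x).
    + apply Dm. lra.
    + unfold f, d. rewrite Rabs_right by lra. f_equal.
      (* The factor [x = exp (ln x)] of the denominator is absorbed into the exponential. *)
      replace (nu * ln x + G x) with (ln x + ((nu - 1) * ln x + G x)) by ring.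
      rewrite (exp_plus (ln x)), exp_ln by auto. ring.
  - intros eps Heps. destruct (LF eps Heps) as [M HM]. exists M. intros x Hx.
    unfold m. rewrite F0. replace (F x - _ - _) with (F x - 0) by ring. auto.
  - intros x. replace (fun y => m y - (mu - nu) * atan y)
      with (fun y => F y - (mu - nu) * theta y); [apply HH|].
    apply functional_extensionality. intros y. unfold m. rewrite theta_atan, F0. ring.
Qed.

(** * Elementary inequalities and the size of [h] *)

Lemma exp_le (x y : R) : x <= y -> exp x <= exp y.
Proof.
  intros [H| ->]; [left; apply exp_increasing; auto | right; reflexivity].
Qed.

(** The expression [ln x + Rmax (ln t - ln x) 0] is the logarithm of the larger of [t] and [x],
    whose square is within a factor [2] of [t^2 + x^2]. *)
Lemma ln_sum_sqr_max (t x : R) : 0 < t -> 0 < x ->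
  0 <= ln (t ^ 2 + x ^ 2) - 2 * (ln x + Rmax (ln t - ln x) 0) <= ln 2.
Proof.
  intros Ht Hx.
  assert (L : forall y, 0 < y -> ln (y ^ 2) = 2 * ln y).
  { intros y Hy. replace (y ^ 2) with (y * y) by ring. rewrite ln_mult by auto. ring. }
  assert (L2 : forall y, 0 < y -> ln (2 * y ^ 2) = ln 2 + 2 * ln y).
  { intros y Hy. rewrite ln_mult, L by (auto; nra || lra). reflexivity. }
  destruct (Rle_dec t x) as [H|H].
  - assert (ln t <= ln x) by (apply ln_le; auto).
    rewrite Rmax_right by lra.
    assert (ln (x ^ 2) <= ln (t ^ 2 + x ^ 2)) by (apply ln_le; nra).
    assert (ln (t ^ 2 + x ^ 2) <= ln (2 * x ^ 2)) by (apply ln_le; nra).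
    rewrite L in * by auto. rewrite L2 in * by auto. lra.
  - assert (ln x <= ln t) by (apply ln_le; lra).
    rewrite Rmax_left by lra.
    assert (ln (t ^ 2) <= ln (t ^ 2 + x ^ 2)) by (apply ln_le; nra).
    assert (ln (t ^ 2 + x ^ 2) <= ln (2 * t ^ 2)) by (apply ln_le; nra).
    rewrite L in * by auto. rewrite L2 in * by auto. lra.
Qed.

Lemma le_limit_of_nondecreasing (m : R -> R) (l : R) :
  (forall x y, 0 <= x -> x <= y -> m x <= m y) -> lim_pinf m l ->
  forall x, 0 <= x -> m x <= l.
Proof.
  intros Hm Hl x Hx. apply le_epsilon. intros eps Heps.
  destruct (Hl eps Heps) as [M HM].
  assert (H1 := Rmax_l M x). assert (H2 := Rmax_r M x).
  specialize (HM (Rmax M x + 1) ltac:(lra)).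
  assert (m x <= m (Rmax M x + 1)) by (apply Hm; lra).
  apply Rabs_def2 in HM. lra.
Qed.

(** On [(0, x)] the derivative of [h] at [z] is at most [z^(nu - 1) * exp (G x)], whose integral is
    [x^nu * exp (G x) / nu]. *)
Lemma hinv_upper (nu : R) (h G : R -> R) :
  0 < nu -> continuity h -> h 0 = 0 ->
  (forall x, 0 < x -> derivable_pt_lim h x (exp ((nu - 1) * ln x + G x))) ->
  (forall x y, 0 <= x -> x <= y -> G x <= G y) ->
  forall x, 0 < x -> nu * h x <= exp (nu * ln x + G x).
Proof.
  intros Hnu Ch h0 Dh HG x Hx.
  (* [exp (nu * ln y)] is not continuous at [0] because [ln 0 = 0], so compare on [[y, x]] and let [y -> 0]. *)
  assert (Hy : forall y, 0 < y < x -> nu * h x <= exp (nu * ln x + G x) + nu * h y).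
  { intros y Hy.
    assert (D : forall z, 0 < z -> derivable_pt_lim
      (fun z => exp (nu * ln z + G x) - nu * h z) z
      (nu / z * exp (nu * ln z + G x) - nu * exp ((nu - 1) * ln z + G z))).
    { intros z Hz. apply derivable_pt_lim_minus.
      - apply is_derive_Reals. auto_derive; auto. field. lra.
      - apply derivable_pt_lim_scal, Dh, Hz. }
    assert (Hle : exp (nu * ln y + G x) - nu * h y <= exp (nu * ln x + G x) - nu * h x).
    { eapply (le_of_derive_nonneg (fun z => exp (nu * ln z + G x) - nu * h z)); [lra | | |].
      - intros z Hz. apply D. lra.
      - intros z Hz. eapply derivable_pt_lim_continuity_pt, D. lra.
      - intros z Hz. simpl.
        replace (nu * ln z + G x) with (ln z + ((nu - 1) * ln z + G x)) by ring.
        rewrite (exp_plus (ln z)), exp_ln by lra.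
        replace (nu / z * (z * exp ((nu - 1) * ln z + G x)))
          with (nu * exp ((nu - 1) * ln z + G x)) by (field; lra).
        assert (exp ((nu - 1) * ln z + G z) <= exp ((nu - 1) * ln z + G x)); [|nra].
        apply exp_le. assert (G z <= G x) by (apply HG; lra). lra. }
    assert (0 < exp (nu * ln y + G x)) by apply exp_pos. lra. }
  apply le_epsilon. intros eps Heps.
  destruct (Ch 0 (eps / nu)) as (al & Hal & Hc); [apply Rdiv_lt_0_compat; auto|].
  set (y := Rmin al x / 2).
  assert (Hya : 0 < y < al /\ y < x).
  { unfold y. assert (0 < Rmin al x) by (apply Rmin_pos; auto).
    assert (Rmin al x <= al) by apply Rmin_l. assert (Rmin al x <= x) by apply Rmin_r. lra. }
  assert (Hhy : Rabs (h y) < eps / nu).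
  { assert (H := Hc y). simpl in H. unfold R_dist in H.
    rewrite h0, !Rminus_0_r in H. apply H. split; [split; [exact I | lra]|].
    rewrite Rabs_right; lra. }
  apply Rabs_def2 in Hhy.
  assert (nu * h y <= eps).
  { apply Rle_trans with (nu * (eps / nu)); [nra|]. right. field. lra. }
  specialize (Hy y ltac:(lra)). lra.
Qed.

(** Only [[x / 2, x]] is used: there the derivative is at least [x^(nu - 1) * exp (G (x / 2))],
    because [nu - 1 < 0] and [G] increases. *)
Lemma hinv_lower (nu : R) (h G : R -> R) :
  nu < 1 -> continuity h -> h 0 = 0 ->
  (forall x, 0 < x -> derivable_pt_lim h x (exp ((nu - 1) * ln x + G x))) ->
  (forall x y, 0 <= x -> x <= y -> G x <= G y) ->
  forall x, 0 < x -> exp (nu * ln x + G (x / 2)) <= 2 * h x.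
Proof.
  intros Hnu Ch h0 Dh HG x Hx.
  assert (0 <= h (x / 2)).
  { rewrite <- h0. apply (le_of_derive_nonneg h (fun x => exp ((nu - 1) * ln x + G x))); [lra| | |].
    - intros y Hy. apply Dh. lra.
    - intros y _. apply Ch.
    - intros y _. apply Rlt_le, exp_pos. }
  destruct (MVT_open h (fun x => exp ((nu - 1) * ln x + G x)) (x / 2) x) as (c & Hc & E).
  - lra.
  - intros y Hy. apply Dh. lra.
  - intros y _. apply Ch.
  - assert (Hle : exp ((nu - 1) * ln x + G (x / 2)) <= exp ((nu - 1) * ln c + G c)).
    { apply exp_le.
      assert (ln c <= ln x) by (apply ln_le; lra).
      assert (G (x / 2) <= G c) by (apply HG; lra). nra. }
    replace (nu * ln x + G (x / 2)) with (ln x + ((nu - 1) * ln x + G (x / 2))) by ring.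
    rewrite (exp_plus (ln x)), exp_ln by lra.
    replace (x - x / 2) with (x / 2) in E by lra. nra.
Qed.

(** * Comparison with the Liouville equation in the variable [ln x] *)

Lemma derivable_pt_lim_comp_exp (f : R -> R) (u l : R) :
  derivable_pt_lim f (exp u) l -> derivable_pt_lim (fun u => f (exp u)) u (l * exp u).
Proof.
  intros H. apply (derivable_pt_lim_comp exp f); auto. apply derivable_pt_lim_exp.
Qed.

(** The unknown quantities [kappa] and [G 1] enter both constants of the differential inequality
    through the common factor [K] and cancel in their ratio, so the bound depends only on [nu], [q]
    and [D]. *)
Lemma log_profile (nu q D kappa : R) (h m G : R -> R) :
  0 < nu < 1 / 2 -> 0 < q -> 0 < kappa ->
  continuity h -> h 0 = 0 ->
  (forall x, 0 < x -> derivable_pt_lim h x (exp ((nu - 1) * ln x + G x))) ->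
  (forall x y, 0 <= x -> x <= y -> G x <= G y) ->
  continuity m -> odd_profile m ((1 / 2 - nu + q) * (PI / 2)) ->
  (forall x, 0 < x -> derivable_pt_lim m x (kappa / (h x * exp (nu * ln x + G x)))) ->
  lim_pinf m ((1 / 2 - nu + q) * (PI / 2)) ->
  let J := fun x => 2 / PI * RInt (fun r => m r / r) 1 x in
  (forall s t, 0 < s -> 0 < t -> Rabs (G t - G s - (J t - J s)) <= D) ->
  exists x0, 0 < x0 /\ forall t, 0 < t ->
    Rabs (J t - J x0 - (1 / 2 - nu + q) * Rmax (ln t - ln x0) 0)
      <= 2 * exp (5 * D + (1 / 2 - nu + q)) / nu.
Proof.
  intros Hnu Hq Hkap Ch h0 Dh HG Cm Pm Dm Lm J HJ.
  set (p := 1 / 2 - nu) in *. set (al := p + q) in *.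
  assert (HPI := PI_RGT_0).
  assert (DJ : forall x, 0 < x -> derivable_pt_lim J x (2 / PI * (m x / x))).
  { intros x Hx. apply derivable_pt_lim_scal.
    apply (RInt_from_1_derive (fun r => m r / r)); auto.
    intros; apply continuity_pt_div_id; auto. }
  assert (J1 : J 1 = 0).
  { unfold J. rewrite RInt_point. unfold zero; simpl. ring. }
  assert (H2PI : 0 < 2 / PI) by (apply Rdiv_lt_0_compat; lra).
  assert (mb : forall x, 0 <= x -> 0 <= 2 / PI * m x <= al).
  { intros x Hx. destruct Pm as (_ & Hb & _). specialize (Hb x Hx).
    replace al with (2 / PI * (al * (PI / 2))) by (field; lra).
    split; [apply Rmult_le_pos; lra | apply Rmult_le_compat_l; lra]. }
  (* Since [J' y <= al / y], the increment of [J] over [[x / 2, x]] is at most [al]. This absorbs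
     the shift to [x / 2] in [hinv_lower]. *)
  assert (Hhalf : forall x, 0 < x -> G x - G (x / 2) <= D + al).
  { intros x Hx. assert (H := HJ (x / 2) x ltac:(lra) Hx).
    destruct (MVT_open J (fun x => 2 / PI * (m x / x)) (x / 2) x) as (c & Hc & E); [lra| | |].
    - intros y Hy. apply DJ. lra.
    - intros y Hy. eapply derivable_pt_lim_continuity_pt, DJ. lra.
    - assert (J x - J (x / 2) <= al).
      { rewrite E. replace (2 / PI * (m c / c) * (x - x / 2))
          with (2 / PI * m c * ((x / 2) / c)) by (field; lra).
        assert (0 <= 2 / PI * m c <= al) by (apply mb; lra).
        assert (0 < (x / 2) / c <= 1); [|nra].
        split; [apply Rdiv_lt_0_compat; lra|].
        apply (Rmult_le_reg_r c); [lra|]. unfold Rdiv. rewrite (Rmult_assoc _ (/ c)), Rinv_l; lra. }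
      apply Rabs_le_between in H. lra. }
  pose (phi := fun u => J (exp u)).
  pose (n := fun u => 2 / PI * m (exp u)).
  pose (f := fun x => kappa / (h x * exp (nu * ln x + G x))).
  pose (N := fun u => 2 / PI * (f (exp u) * exp u)).
  pose (E := fun u => exp (2 * p * u - 2 * phi u)).
  assert (Dphi : forall u, derivable_pt_lim phi u (n u)).
  { intros u. assert (Hu := exp_pos u). unfold n.
    replace (2 / PI * m (exp u)) with (2 / PI * (m (exp u) / exp u) * exp u) by (field; lra).
    apply derivable_pt_lim_comp_exp, DJ, Hu. }
  assert (Dn : forall u, derivable_pt_lim n u (N u)).
  { intros u. apply derivable_pt_lim_scal, derivable_pt_lim_comp_exp, Dm, exp_pos. }
  assert (DE : forall u, derivable_pt_lim E u (2 * (p - n u) * E u)).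
  { intros u. unfold E.
    replace (2 * (p - n u) * exp (2 * p * u - 2 * phi u))
      with (exp (2 * p * u - 2 * phi u) * (2 * p * 1 - 2 * n u)) by ring.
    apply (derivable_pt_lim_comp (fun u => 2 * p * u - 2 * phi u) exp).
    - apply derivable_pt_lim_minus; apply derivable_pt_lim_scal; auto.
      apply derivable_pt_lim_id.
    - apply derivable_pt_lim_exp. }
  pose (K := 2 / PI * kappa * exp (- 2 * G 1)).
  assert (HK : 0 < K).
  { unfold K. apply Rmult_lt_0_compat; [apply Rmult_lt_0_compat; auto | apply exp_pos]. }
  assert (hpos : forall x, 0 < x -> 0 < h x).
  { intros x Hx. assert (H := hinv_lower nu h G ltac:(lra) Ch h0 Dh HG x Hx).
    assert (H' := exp_pos (nu * ln x + G (x / 2))). lra. }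
  assert (HN : forall u, K * nu * exp (- 2 * D) * E u <= N u
                         <= K * 2 * exp (3 * D + al) * E u).
  { intros u. assert (Hx := exp_pos u). assert (Lx := ln_exp u).
    set (x := exp u) in *.
    assert (Hh := hpos x Hx).
    assert (Up := hinv_upper nu h G ltac:(lra) Ch h0 Dh HG x Hx).
    assert (Lo := hinv_lower nu h G ltac:(lra) Ch h0 Dh HG x Hx).
    assert (HG1 := HJ 1 x Rlt_0_1 Hx). rewrite J1 in HG1.
    change (J x) with (phi u) in HG1. apply Rabs_le_between in HG1.
    specialize (Hhalf x Hx). rewrite Lx in *.
    set (a := exp (nu * u + G x)) in *.
    assert (Ha : 0 < a) by apply exp_pos.
    assert (Lo' : a <= exp (D + al) * (2 * h x)).
    { apply Rle_trans with (exp (D + al) * exp (nu * u + G (x / 2))).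
      - rewrite <- exp_plus. apply exp_le. lra.
      - apply Rmult_le_compat_l; auto. apply Rlt_le, exp_pos. }
    assert (EN : N u = 2 / PI * kappa * (x * / (h x * a))).
    { unfold N, f. fold x. rewrite Lx. fold a. field. split; [lra | split; lra]. }
    (* The bounds on [h] make it comparable to [a], so [/ (h x * a)] may be replaced by [/ (a * a)],
       and [x / a^2 = exp (2 p u - 2 G x)]. *)
    assert (Hq1 : nu * / (a * a) <= / (h x * a)).
    { apply (Rmult_le_reg_r (h x * a * a)); [repeat apply Rmult_lt_0_compat; auto|].
      replace (nu * / (a * a) * (h x * a * a)) with (nu * h x) by (field; lra).
      replace (/ (h x * a) * (h x * a * a)) with a by (field; lra). exact Up. }
    assert (Hq2 : / (h x * a) <= 2 * exp (D + al) * / (a * a)).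
    { apply (Rmult_le_reg_r (h x * a * a)); [repeat apply Rmult_lt_0_compat; auto|].
      replace (2 * exp (D + al) * / (a * a) * (h x * a * a))
        with (exp (D + al) * (2 * h x)) by (field; lra).
      replace (/ (h x * a) * (h x * a * a)) with a by (field; lra). exact Lo'. }
    assert (Exa : x * / (a * a) = exp (2 * p * u - 2 * G x)).
    { unfold a, x. rewrite <- exp_plus, <- exp_Ropp, <- exp_plus. f_equal. unfold p. field. }
    (* Replacing [G x] by [G 1 + J x] costs at most [D], doubled in the exponent. *)
    assert (W1 : exp (- 2 * D) * exp (- 2 * G 1) * E u <= x * / (a * a)).
    { rewrite Exa. unfold E. rewrite <- !exp_plus. apply exp_le. lra. }
    assert (W2 : x * / (a * a) <= exp (2 * D) * exp (- 2 * G 1) * E u).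
    { rewrite Exa. unfold E. rewrite <- !exp_plus. apply exp_le. lra. }
    assert (HkP : 0 < 2 / PI * kappa) by (apply Rmult_lt_0_compat; auto).
    rewrite EN. unfold K. split.
    - replace (2 / PI * kappa * exp (-2 * G 1) * nu * exp (-2 * D) * E u)
        with (2 / PI * kappa * (nu * (exp (- 2 * D) * exp (- 2 * G 1) * E u))) by ring.
      apply Rmult_le_compat_l; [lra|].
      apply Rle_trans with (nu * (x * / (a * a))).
      + apply Rmult_le_compat_l; lra.
      + replace (nu * (x * / (a * a))) with (x * (nu * / (a * a))) by ring.
        apply Rmult_le_compat_l; lra.
    - replace (3 * D + al) with (D + al + 2 * D) by ring. rewrite (exp_plus (D + al)).
      replace (2 / PI * kappa * exp (-2 * G 1) * 2 * (exp (D + al) * exp (2 * D)) * E u)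
        with (2 / PI * kappa * (2 * exp (D + al) * (exp (2 * D) * exp (- 2 * G 1) * E u))) by ring.
      apply Rmult_le_compat_l; [lra|].
      apply Rle_trans with (2 * exp (D + al) * (x * / (a * a))).
      + replace (2 * exp (D + al) * (x * / (a * a)))
          with (x * (2 * exp (D + al) * / (a * a))) by ring.
        apply Rmult_le_compat_l; lra.
      + apply Rmult_le_compat_l; auto.
        assert (H := exp_pos (D + al)). lra. }
  assert (m0 : m 0 = 0).
  { destruct Pm as (Hodd & _). specialize (Hodd 0). rewrite Ropp_0 in Hodd. lra. }
  assert (nl : forall eps, 0 < eps -> exists M, forall u, u < M -> n u < eps).
  { intros eps Heps.
    destruct (Cm 0 (eps * (PI / 2))) as (dl & Hdl & Hc); [apply Rmult_lt_0_compat; lra|].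
    exists (ln dl). intros u Hu. assert (Hx := exp_pos u).
    assert (Hxd : exp u < dl) by (rewrite <- (exp_ln dl) by auto; apply exp_increasing, Hu).
    assert (H := Hc (exp u)). simpl in H. unfold R_dist in H.
    rewrite m0, !Rminus_0_r in H.
    assert (H' : Rabs (m (exp u)) < eps * (PI / 2)).
    { apply H. split; [split; [exact I | lra]|]. rewrite Rabs_right; lra. }
    apply Rabs_def2 in H'. unfold n.
    replace eps with (2 / PI * (eps * (PI / 2))) by (field; lra).
    apply Rmult_lt_compat_l; lra. }
  assert (nr : forall eps, 0 < eps -> exists M, forall u, M < u -> p + q - eps < n u).
  { intros eps Heps.
    destruct (Lm (eps * (PI / 2))) as (M & HM); [apply Rmult_lt_0_compat; lra|].
    exists (ln (Rmax M 1)). intros u Hu.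
    assert (H1 := Rmax_l M 1). assert (H2 := Rmax_r M 1).
    assert (Hxd : Rmax M 1 < exp u).
    { rewrite <- (exp_ln (Rmax M 1)) by lra. apply exp_increasing, Hu. }
    specialize (HM (exp u) ltac:(lra)). apply Rabs_def2 in HM. unfold n.
    replace (p + q - eps) with (2 / PI * (al * (PI / 2) - eps * (PI / 2)))
      by (unfold al; field; lra).
    apply Rmult_lt_compat_l; lra. }
  assert (Hp : 0 < p) by (unfold p; lra).
  assert (Hu0 : exists u0, n u0 = p).
  (* The tolerance [p] on the left and [q] on the right put [n] below and above the level [p]. *)
  { destruct (nl p Hp) as [M1 HM1]. destruct (nr q Hq) as [M2 HM2].
    assert (Cn : continuity n).
    { intros u. eapply derivable_pt_lim_continuity_pt, Dn. }
    specialize (HM1 (M1 - 1) ltac:(lra)). specialize (HM2 (M2 + 1) ltac:(lra)).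
    destruct (IVT_gen n (M1 - 1) (M2 + 1) p Cn) as (u0 & _ & Hn).
    - rewrite Rmin_left, Rmax_right by lra. lra.
    - exists u0; exact Hn. }
  destruct Hu0 as [u0 Hu0].
  exists (exp u0). split; [apply exp_pos|]. intros t Ht.
  assert (HL := liouville_line phi n N E p q (K * nu * exp (- 2 * D))
    (K * 2 * exp (3 * D + al)) u0 Hp Hq).
  specialize (HL ltac:(repeat apply Rmult_lt_0_compat; (lra || apply exp_pos))
                 ltac:(repeat apply Rmult_lt_0_compat; (lra || apply exp_pos))
                 Dphi Dn DE (fun u => exp_pos _) HN).
  specialize (HL (fun u => mb (exp u) (Rlt_le _ _ (exp_pos u))) nl nr Hu0 (ln t)).
  unfold phi in HL. rewrite exp_ln in HL by auto. rewrite ln_exp.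
  replace (2 * exp (5 * D + al) / nu)
    with (K * 2 * exp (3 * D + al) / (K * nu * exp (- 2 * D))); [exact HL|].
  replace (5 * D + al) with (3 * D + al + - (- 2 * D)) by ring.
  rewrite (exp_plus (3 * D + al)), exp_Ropp. field.
  split; [|split]; try lra. apply Rgt_not_eq, exp_pos.
Qed.

(** * Assembling the estimate *)

Lemma ln_2_le_1 : ln 2 <= 1.
Proof.
  rewrite <- (ln_exp 1). apply ln_le; [lra|].
  assert (H := exp_ineq1 1). lra.
Qed.

Lemma continuity_bound_at_0 (f : R -> R) (c : R) :
  continuity f -> (forall t, 0 < t -> Rabs (f t) <= c) -> Rabs (f 0) <= c.
Proof.
  intros Cf Hf. apply le_epsilon. intros eps Heps.
  destruct (Cf 0 eps Heps) as (d & Hd & Hc).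
  assert (H := Hc (d / 2)). simpl in H. unfold R_dist in H.
  assert (H' : Rabs (f (d / 2) - f 0) < eps).
  { apply H. split; [split; [exact I | lra]|]. rewrite Rminus_0_r, Rabs_right; lra. }
  specialize (Hf (d / 2) ltac:(lra)).
  rewrite Rabs_minus_sym in H'.
  replace (f 0) with (f 0 - f (d / 2) + f (d / 2)) by ring.
  eapply Rle_trans; [apply Rabs_triang|]. lra.
Qed.

Theorem theorem3p1 (mu nu : R) :
  1 / 2 < mu <= 2 -> 0 < nu < 1 / 2 ->
  exists c : R,
    forall g : R -> R,
      continuity g ->
      (exists B, forall x, Rabs (g x) <= B) ->
      solves_312 mu nu g ->
      (forall x, Gof mu nu g (- x) = Gof mu nu g x) ->
      (forall x y, 0 <= x -> x <= y -> Gof mu nu g x <= Gof mu nu g y) ->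
      exists x0, 0 < x0 /\
        forall x,
          Rabs (Gof mu nu g x - (mu - nu) / 2 * ln (x ^ 2 + x0 ^ 2)) <= c.
Proof.
  intros Hmu Hnu.
  (* The hypotheses on [mu] and [nu] say that [al] splits into the positive parts [p = 1/2 - nu] and
     [q]. *)
  set (al := mu - nu). set (q := mu - 1 / 2).
  set (D := 14 * al + 2).
  set (K := 2 * exp (5 * D + al) / nu).
  (* The sum of [D + K] for [G t - G x0], of [D + K + (6 * al + 3) + al / 2] for
     [G x0 - al * ln x0], and of [al / 2] for replacing the maximum by the sum of squares. *)
  exists (2 * (D + K) + (6 * al + 3) + al).
  intros g Cg _ Hsol Heven Hmono.
  assert (Hal : 0 < al) by (unfold al; lra).
  destruct (solution_structure mu nu g Cg Hsol Heven)
    as (kappa & h & m & Hk & Ch & h0 & Dh & Cm & modd & Dm & Lm & HH).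
  fold al in Lm, HH |- *.
  set (G := Gof mu nu g) in *.
  assert (CG : continuity G) by (apply continuity_Gof; auto).
  pose (f := fun x => kappa / (h x * exp (nu * ln x + G x))).
  assert (hmono : forall x y, 0 <= x -> x <= y -> h x <= h y).
  { intros x y Hx Hxy.
    apply (le_of_derive_nonneg h (fun x => exp ((nu - 1) * ln x + G x))); auto.
    - intros z Hz. apply Dh. lra.
    - intros z _. apply Rlt_le, exp_pos. }
  assert (hpos : forall x, 0 < x -> 0 < h x).
  { intros x Hx. assert (H := hinv_lower nu h G ltac:(lra) Ch h0 Dh Hmono x Hx).
    assert (H' := exp_pos (nu * ln x + G (x / 2))). lra. }
  assert (Hden : forall x, 0 < x -> 0 < h x * exp (nu * ln x + G x)).
  { intros x Hx. apply Rmult_lt_0_compat; auto. apply exp_pos. }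
  assert (fpos : forall x, 0 < x -> 0 <= f x).
  { intros x Hx. apply Rlt_le, Rdiv_lt_0_compat; auto. }
  assert (fdec : forall x y, 0 < x -> x <= y -> f y <= f x).
  { intros x y Hx Hxy. apply Rmult_le_compat_l; [lra|].
    apply Rinv_le_contravar; auto.
    apply Rmult_le_compat; auto.
    - apply Rlt_le; auto.
    - apply Rlt_le, exp_pos.
    - apply hmono; lra.
    - apply exp_le.
      assert (ln x <= ln y) by (apply ln_le; auto).
      assert (G x <= G y) by (apply Hmono; lra). nra. }
  assert (Pm : odd_profile m (al * (PI / 2))).
  { apply (odd_profile_of_derive m f); auto.
    apply le_limit_of_nondecreasing; auto.
    intros x y Hx Hxy. apply (le_of_derive_nonneg m f); auto.
    - intros z Hz. apply Dm. lra.
    - intros z Hz. apply fpos. lra. }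
  assert (Hincr := fun s t Hs Ht =>
    hilbert_increment m g al s t (Rlt_le _ _ Hal) Cm Pm HH Hs Ht).
  cbv zeta in Hincr.
  assert (Eal : 1 / 2 - nu + q = al) by (unfold q, al; ring).
  destruct (log_profile nu q D kappa h m G) as (x0 & Hx0 & HJ);
    rewrite ?Eal; auto; [unfold q; lra|].
  rewrite Eal in HJ. fold K in HJ.
  assert (HGx : forall t, 0 < t ->
    Rabs (G t - G x0 - al * Rmax (ln t - ln x0) 0) <= D + K).
  { intros t Ht. specialize (HJ t Ht). specialize (Hincr x0 t Hx0 Ht).
    change (Rabs (G t - G x0 - (2 / PI * RInt (fun r => m r / r) 1 t
       - 2 / PI * RInt (fun r => m r / r) 1 x0)) <= D) in Hincr.
    apply Rabs_le_between in HJ, Hincr. apply Rabs_le. lra. }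
  assert (Hl2 := ln_2_le_1).
  (* For one large [t], [G t] is close to [al * ln t] by the bound on [g], and close to
     [G x0 + al * (ln t - ln x0)] by [HGx]; comparing the two fixes [G x0]. *)
  assert (Hbase : Rabs (G x0 - al * ln x0) <= D + K + (6 * al + 3) + al / 2).
  { destruct (hilbert_bound_at_infinity m g al (Rlt_le _ _ Hal) Cm Pm HH) as [M HM].
    set (t := Rmax M (Rmax x0 1) + 1).
    assert (Ht : M < t /\ x0 < t /\ 1 < t).
    { unfold t. assert (H1 := Rmax_l M (Rmax x0 1)). assert (H2 := Rmax_r M (Rmax x0 1)).
      assert (H3 := Rmax_l x0 1). assert (H4 := Rmax_r x0 1). lra. }
    specialize (HM t (proj1 Ht)). specialize (HGx t ltac:(lra)).
    assert (ln x0 <= ln t) by (apply ln_le; lra).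
    assert (0 <= ln t) by (rewrite <- ln_1; apply ln_le; lra).
    rewrite Rmax_left in HGx by lra.
    assert (Hs := ln_sum_sqr_max t 1 ltac:(lra) Rlt_0_1).
    rewrite ln_1, Rmax_left, pow1 in Hs by lra.
    unfold G at 1, Gof in HGx. fold al in HGx.
    apply Rabs_le_between in HM, HGx. apply Rabs_le. nra. }
  exists x0. split; auto.
  assert (Hpos : forall t, 0 < t ->
    Rabs (G t - al / 2 * ln (t ^ 2 + x0 ^ 2)) <= 2 * (D + K) + (6 * al + 3) + al).
  { intros t Ht. specialize (HGx t Ht).
    assert (Hs := ln_sum_sqr_max t x0 Ht Hx0).
    apply Rabs_le_between in HGx, Hbase. apply Rabs_le. nra. }
  (* Negative [x] follow by evenness; [0], which the variable [ln x] does not reach, follows by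
     continuity. *)
  intros x. destruct (Rtotal_order x 0) as [Hx|[->|Hx]]; auto.
  - rewrite <- Heven. replace (x ^ 2) with ((- x) ^ 2) by ring. apply Hpos. lra.
  - apply (continuity_bound_at_0 (fun t => G t - al / 2 * ln (t ^ 2 + x0 ^ 2))); auto.
    intros t. apply (continuity_pt_minus G); [apply CG|].
    apply derivable_pt_lim_continuity_pt with (al / 2 * (2 * t / (t ^ 2 + x0 ^ 2))).
    apply is_derive_Reals. auto_derive; [nra|]. field. nra.
Qed.
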